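(* Let $(\rho_K^n,e_K^n,p_K^n)_{K\in\mathcal M,\,0\le n\le N}$, together with normal face velocities $u_{K,\sigma}^{n}$ and face values $\rho_\sigma^{n},e_\sigma^{n}$, satisfy, for all $K\in\mathcal M$ and $0\le n\le N-1$, the implicit scheme $$\frac{|K|}{\delta t}(\rho_K^{n+1}-\rho_K^n)+\sum_{\sigma\in\mathcal E(K)}F_{K,\sigma}^{n+1}=0,$$ $$\frac{|K|}{\delta t}(\rho_K^{n+1}e_K^{n+1}-\rho_K^ne_K^n)+\sum_{\sigma\in\mathcal E(K)}F_{K,\sigma}^{n+1}e_\sigma^{n+1}+p_K^{n+1}\sum_{\sigma\in\mathcal E(K)}|\sigma|\,u_{K,\sigma}^{n+1}\ge 0,$$ $$p_K^{n+1}=(\gamma-1)\rho_K^{n+1}e_K^{n+1},\qquad F_{K,\sigma}^{n+1}=|\sigma|\,\rho_\sigma^{n+1}u_{K,\sigma}^{n+1},$$ where the face values are given by the first-order upwind choice: for $\sigma=K|L\in\mathcal E_{\rm int}$, $(\rho_\sigma^{n+1},e_\sigma^{n+1})=(\rho_K^{n+1},e_K^{n+1})$ if $u_{K,\sigma}^{n+1}\ge0$, and $(\rho_\sigma^{n+1},e_\sigma^{n+1})=(\rho_L^{n+1},e_L^{n+1})$ otherwise. Let $\eta(\rho,e)=\rho\ln\rho-\frac{1}{\gamma-1}\rho\ln e$ for $\rho,e>0$, and set $\eta_K^m=\eta(\rho_K^m,e_K^m)$ for $m=n,n+1$ and $K\in\mathcal M$, and $\eta_\sigma^{n+1}=\eta(\rho_\sigma^{n+1},e_\sigma^{n+1})$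 for $\sigma\in\mathcal E_{\rm int}$. Then, for every $K\in\mathcal M$ and $0\le n\le N-1$, $$\frac{|K|}{\delta t}(\eta_K^{n+1}-\eta_K^n)+\sum_{\sigma\in\mathcal E(K)}|\sigma|\,\eta_\sigma^{n+1}u_{K,\sigma}^{n+1}\le 0.$$
   Context: $\Omega\subset\mathbb R^d$, $1\le d\le3$, is a bounded connected open set; $\gamma>1$ is a real constant. $\mathcal M$ is a (finite element type, regular) mesh of $\Omega$ into cells $K$; $\mathcal E(K)$ is the set of $(d-1)$-faces of $K$; $\mathcal E_{\rm int}$ and $\mathcal E_{\rm ext}$ are the sets of faces included in $\Omega$ and in $\partial\Omega$; $\sigma=K|L$ denotes the internal face separating $K$ and $L$. $|K|$ is the $d$-measure of $K$ and $|\sigma|$ the $(d-1)$-measure of $\sigma$. The time interval $(0,T)$ is divided uniformly, $0=t_0<\dots<t_N=T$, with step $\delta t=t_{n+1}-t_n>0$. $u_{K,\sigma}^n\in\mathbb R$ approximates the velocity component normal to $\sigma$ and outward $K$; thus $u_{K,\sigma}^n=-u_{L,\sigma}^n$ for $\sigma=K|L$, and $u_{K,\sigma}^n=0$ for $\sigma\in\mathcal E_{\rm ext}$ (so that the terms associated with external faces vanish in all sums). All $\rho_K^n,e_K^n$ $(K\in\mathcal M,\ 0\le n\le N)$ and all face values $\rho_\sigma^n,e_\sigma^n$ $(\sigma\in\mathcal E_{\rm int})$ are assumed positive. *)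

(* Defs.v *)
(* MathComp-Analysis, over an arbitrary R : realType. *)
From mathcomp Require Import all_boot all_order all_algebra.
From mathcomp Require Import all_classical all_reals all_analysis.
Import Order.TTheory GRing.Theory Num.Theory.
Import numFieldNormedType.Exports.

Set Implicit Arguments.
Unset Strict Implicit.
Unset Printing Implicit Defensive.

Local Open Scope classical_set_scope.
Local Open Scope ring_scope.

(* The library has no Lebesgue measure on R^d: this is the d-dimensional
   Lebesgue outer measure, by countable covers with closed boxes (a box with
   a_i > b_i for some i is empty and has volume 0). *)
Definition box (R : realType) (d : nat) (a b : 'rV[R]_d) : set 'rV[R]_d :=
  [set x | forall i, a 0 i <= x 0 i <= b 0 i].

Definition box_volume (R : realType) (d : nat) (a b : 'rV[R]_d) : R :=
  \prod_(i < d) Num.max 0 (b 0 i - a 0 i).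

Definition lebesgue_outer (R : realType) (d : nat) (A : set 'rV[R]_d) : \bar R :=
  ereal_inf [set s : \bar R | exists a b : nat -> 'rV[R]_d,
    A `<=` \bigcup_k box (a k) (b k) /\
    s = (\sum_(0 <= k <oo) (box_volume (a k) (b k))%:E)%E].

(* The norm that the library puts on 'rV[R]_d is the sup norm; it is adequate
   for the topology, but Hausdorff measures need the Euclidean distance. *)
Definition edist (R : realType) (d : nat) (x y : 'rV[R]_d) : R :=
  Num.sqrt (\sum_(i < d) (x 0 i - y 0 i) ^+ 2).

Definition ediam (R : realType) (d : nat) (A : set 'rV[R]_d) : \bar R :=
  ereal_sup [set (edist xy.1 xy.2)%:E | xy in A `*` A].

(* Volume of the Euclidean unit ball of R^s: 1, 2, pi, 4 pi / 3, ... *)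
Fixpoint unit_ball_volume (R : realType) (s : nat) : R :=
  match s with
  | 0%N => 1
  | 1%N => 2
  | S (S r as q) => 2 * pi / q.+1%:R * unit_ball_volume R r
  end.

(* The s-dimensional Hausdorff (outer) measure, normalized so that it is the
   counting measure for s = 0, the length for s = 1, the area for s = 2.
   The test on the emptiness of A matters for s = 0. *)
Definition hausdorff_gauge (R : realType) (d s : nat) (A : set 'rV[R]_d) :
    \bar R :=
  if `[< A !=set0 >]
  then ((unit_ball_volume R s / 2 ^+ s)%:E * ediam A ^+ s)%E else 0%E.

Definition hausdorff_measure (R : realType) (d s : nat) (A : set 'rV[R]_d) :
    \bar R :=
  ereal_sup [set h : \bar R | exists2 delta : R, 0 < delta &
    h = ereal_inf [set r : \bar R | exists U : nat -> set 'rV[R]_d,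
          [/\ A `<=` \bigcup_k U k,
              forall k, (ediam (U k) <= delta%:E)%E &
              r = (\sum_(0 <= k <oo) hausdorff_gauge s (U k))%E]]].

Definition convex_hull (R : realType) (d m : nat) (v : 'I_m -> 'rV[R]_d) :
    set 'rV[R]_d :=
  [set x | exists w : 'I_m -> R,
    [/\ forall i, 0 <= w i, \sum_(i < m) w i = 1 &
        x = \sum_(i < m) w i *: v i]].

(* S is a facet of P: the intersection of P with a supporting hyperplane,
   containing d affinely independent points x0, x0 + row i V. *)
Definition facet (R : realType) (d : nat) (P S : set 'rV[R]_d) : Prop :=
  exists (a : 'rV[R]_d) (b : R),
    [/\ a != 0,
        forall x, P x -> (x *m a^T) 0 0 <= b,
        S = P `&` [set x | (x *m a^T) 0 0 = b] &
        exists x0 (V : 'M[R]_(d.-1, d)),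
          [/\ row_free V, S x0 & forall i, S (x0 + row i V)]].

(* Relative interiors of the facets of the polytope P: a point of a facet is
   in its relative boundary iff it belongs to another facet. *)
Definition open_facets (R : realType) (d : nat) (P : set 'rV[R]_d) :
    set (set 'rV[R]_d) :=
  [set G | exists2 S, facet P S &
    G = [set x | S x /\ forall S', facet P S' -> S' x -> S' = S]].

(* K is a finite element type cell with set of (relatively open) faces F: the
   image of a nondegenerate convex polytope, and of its open facets, under a
   bi-Lipschitz map.  Taking the identity for Phi gives the simplices and the
   other convex polytopes; other choices give, e.g., the images of
   the reference cube by a nondegenerate multilinear map. *)
Definition finite_element_cell (R : realType) (d : nat) (K : set 'rV[R]_d)
    (F : set (set 'rV[R]_d)) : Prop :=
  exists (m : nat) (v : 'I_m -> 'rV[R]_d) (Phi : 'rV[R]_d -> 'rV[R]_d),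
    let P := convex_hull v in
    [/\ interior P !=set0,
        exists c C : R, 0 < c /\ forall x y, P x -> P y ->
          c * `|x - y| <= `|Phi x - Phi y| <= C * `|x - y|,
        K = Phi @` P &
        F = [set Phi @` G | G in open_facets P]].

(* Conforming mesh, in the usual sense of the finite element literature.  Cells
   are closed; faces are relatively open, so that an internal face is included
   in Omega even if its boundary meets that of Omega. *)
Record mesh (R : realType) (d : nat) (Omega : set 'rV[R]_d) := Mesh {
  cell : finType;
  face : finType;
  cell_set : cell -> set 'rV[R]_d;
  face_set : face -> set 'rV[R]_d;
  faces : cell -> {set face};
  cell_finite_element : forall K,
    finite_element_cell (cell_set K) (face_set @` [set` faces K]);
  cell_cover : \bigcup_K cell_set K = closure Omega;
  cell_disjoint : forall K L, K != L ->
    interior (cell_set K) `&` interior (cell_set L) = set0;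
  face_set_inj : injective face_set;
  face_of_cell : forall sigma, exists K, sigma \in faces K;
  face_location : forall sigma,
    face_set sigma `<=` Omega \/ face_set sigma `<=` closure Omega `\` Omega;
  face_shared : forall sigma, face_set sigma `<=` Omega ->
    #|[pred K | sigma \in faces K]| = 2%N
}.

Section MeshNotions.
Variables (R : realType) (d : nat) (Omega : set 'rV[R]_d) (M : mesh Omega).

Definition internal (sigma : face M) : Prop := face_set sigma `<=` Omega.

(* Omega is open, hence closure Omega `\` Omega is its boundary. *)
Definition external (sigma : face M) : Prop :=
  face_set sigma `<=` closure Omega `\` Omega.

(* sigma = K|L *)
Definition separates (sigma : face M) (K L : cell M) : Prop :=
  [/\ internal sigma, K != L, sigma \in faces K & sigma \in faces L].

Definition cell_measure (K : cell M) : R := fine (lebesgue_outer (cell_set K)).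

Definition face_measure (sigma : face M) : R :=
  fine (hausdorff_measure d.-1 (face_set sigma)).

(* The first-order upwind choice for one time level.  For u K sigma = 0, the
   formula depends on the order in which the cells sharing sigma are named
   (and the face value is multiplied by 0 in the scheme): it is required for
   one of the two orders.  For u K sigma <> 0 both orders are equivalent, since
   u L sigma = - u K sigma. *)
Definition upwind (u : cell M -> face M -> R) (rho e : cell M -> R)
    (rhof ef : face M -> R) : Prop :=
  forall sigma, internal sigma -> exists K L, separates sigma K L /\
    (rhof sigma, ef sigma) =
      if 0 <= u K sigma then (rho K, e K) else (rho L, e L).

End MeshNotions.

Definition entropy (R : realType) (gamma rho e : R) : R :=
  rho * ln rho - 1 / (gamma - 1) * rho * ln e.

(* Main.v *)
Require Import Defs.
From mathcomp Require Import all_boot all_order all_algebra.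
From mathcomp Require Import all_classical all_reals all_analysis.
From mathcomp Require Import ring lra.
Import Order.TTheory GRing.Theory Num.Theory.
Import numFieldNormedType.Exports.

Set Implicit Arguments.
Unset Strict Implicit.
Unset Printing Implicit Defensive.

Local Open Scope classical_set_scope.
Local Open Scope ring_scope.

(** Let [h = 1 / (gamma - 1)].  In the conservative variables
    [(rho, E) = (rho, rho e)] the entropy is
    [eta = (1 + h) rho ln rho - h rho ln E], which is convex, with partial
    derivatives [a = ln rho + 1 + h - h ln e] in [rho] and [- h / e < 0] in
    [E].  Its tangent plane at the new state of [K] lies below it, so
    [eta_K^{n+1} - eta_K^n] is at most [a] times the increment of [rho] minus
    [h / e] times the increment of [rho e]; the mass balance and the energy
    inequality turn these increments into face sums (the sign of [- h / e] is
    the one for which an inequality in the energy balance is enough).  By the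
    equation of state the pressure term contributes [(h / e) p = rho], which is
    exactly the opposite of the constant term of the tangent plane, since
    [eta - a rho + (h / e) rho e = - rho].  Hence each face [sigma] contributes
    [|sigma| u_{K,sigma}] times the gap between [eta] at the face state and the
    tangent plane at the state of [K] ([entropy_balance_le]).

    The gap is nonnegative ([entropy_gap_ge0]), and the upwind choice makes it
    vanish on the faces where the fluid leaves [K], so that all the
    contributions are nonpositive ([upwind_entropy_gap_le0]). *)

(** * Convexity of the entropy *)

(** The derivative of the entropy with respect to [rho] at fixed [rho e]. *)
Definition entropy_slope (R : realType) (gamma rho e : R) : R :=
  ln rho + 1 + (gamma - 1)^-1 - (gamma - 1)^-1 * ln e.

(** The Bregman divergence of the entropy, as a function of [rho] and
    [rho * e]: its value at [(r', e')] minus that of the tangent plane at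
    [(r, e)], whose constant term is [- r]. *)
Definition entropy_gap (R : realType) (gamma r e r' e' : R) : R :=
  entropy gamma r' e' - entropy_slope gamma r e * r'
  + (gamma - 1)^-1 / e * (r' * e') + r.

Lemma ln_le_subr1 (R : realType) (x : R) : 0 < x -> ln x <= x - 1.
Proof.
move=> x0; have -> : ln x = ln (1 + (x - 1)) by rewrite addrC subrK.
by apply: le_ln1Dx; rewrite ltrBrDr addNr.
Qed.

(** The gap splits into the relative entropies of the densities and of the
    internal energies, both nonnegative by concavity of the logarithm. *)
Lemma entropy_gap_ge0 (R : realType) (gamma r e r' e' : R) :
  1 < gamma -> 0 < r -> 0 < e -> 0 < r' -> 0 < e' ->
  0 <= entropy_gap gamma r e r' e'.
Proof.
move=> gamma1 r0 e0 r'0 e'0.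
have h0 : 0 <= (gamma - 1)^-1 by rewrite invr_ge0 subr_ge0 ltW.
have -> : entropy_gap gamma r e r' e' =
    r' * (r / r' - 1 - ln (r / r'))
    + (gamma - 1)^-1 * r' * (e' / e - 1 - ln (e' / e)).
  rewrite /entropy_gap /entropy_slope /entropy !ln_div ?posrE//.
  by field; rewrite !gt_eqF ?subr_gt0.
by rewrite addr_ge0 ?mulr_ge0 ?(ltW r'0)// subr_ge0 ln_le_subr1 ?divr_gt0.
Qed.

Lemma entropy_gap_diag (R : realType) (gamma r e : R) :
  1 < gamma -> 0 < e -> entropy_gap gamma r e r e = 0.
Proof.
move=> gamma1 e0; rewrite /entropy_gap /entropy_slope /entropy.
by field; rewrite !gt_eqF ?subr_gt0.
Qed.

(** * Nonnegativity of the measures *)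

Lemma lebesgue_outer_ge0 (R : realType) (d : nat) (A : set 'rV[R]_d) :
  (0 <= lebesgue_outer A)%E.
Proof.
apply: le_ereal_inf_tmp => _ [a [b [_ ->]]]; apply: nneseries_ge0 => k _ _.
by rewrite lee_fin; apply: prodr_ge0 => i _; rewrite le_max lexx.
Qed.

Lemma unit_ball_volume_ge0 (R : realType) (s : nat) :
  0 <= unit_ball_volume R s.
Proof.
(* The recursion has step two. *)
suff : 0 <= unit_ball_volume R s /\ 0 <= unit_ball_volume R s.+1 by case.
elim: s => [|s [IHs IHs1]]; first by split.
split=> //; rewrite /= -/(unit_ball_volume R s).
by rewrite !mulr_ge0 ?invr_ge0 ?ler0n ?pi_ge0.
Qed.

Lemma hausdorff_gauge_ge0 (R : realType) (d s : nat) (A : set 'rV[R]_d) :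
  (0 <= hausdorff_gauge s A)%E.
Proof.
rewrite /hausdorff_gauge; case: asboolP => // -[x Ax].
apply: mule_ge0.
  by rewrite lee_fin mulr_ge0 ?unit_ball_volume_ge0// invr_ge0 exprn_ge0.
apply: expe_ge0; apply: le_trans (ereal_sup_ubound _); last first.
  by exists (x, x).
by rewrite lee_fin sqrtr_ge0.
Qed.

Lemma hausdorff_measure_ge0 (R : realType) (d s : nat) (A : set 'rV[R]_d) :
  (0 <= hausdorff_measure s A)%E.
Proof.
(* The supremum is bounded below by the term of any [delta], here [1]. *)
apply: le_ereal_sup_tmp; eexists.
  by exists 1; [exact: ltr01 | reflexivity].
apply: le_ereal_inf_tmp => _ [U [_ _ ->]]; apply: nneseries_ge0 => k _ _.
exact: hausdorff_gauge_ge0.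
Qed.

(** * The entropy balance of a cell *)

(** Discrete counterpart of multiplying the mass balance by the derivative of
    the entropy in [rho], and the energy balance by its derivative in
    [rho e].  The face states are arbitrary here, and [c] stands for
    [|K| / dt], [m] for the face measures. *)
Lemma entropy_balance_le (R : realType) (I : finType) (A : {set I})
    (gamma c r0 e0 r e : R) (m v rf ef : I -> R) :
  1 < gamma -> 0 <= c -> 0 < r0 -> 0 < e0 -> 0 < r -> 0 < e ->
  c * (r - r0) + \sum_(i in A) m i * rf i * v i = 0 ->
  0 <= c * (r * e - r0 * e0) + \sum_(i in A) m i * rf i * v i * ef i
       + (gamma - 1) * r * e * \sum_(i in A) m i * v i ->
  c * (entropy gamma r e - entropy gamma r0 e0)
  + \sum_(i in A) m i * entropy gamma (rf i) (ef i) * v i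
  <= \sum_(i in A) m i * (v i * entropy_gap gamma r e (rf i) (ef i)).
Proof.
move=> gamma1 c0 r0_gt0 e0_gt0 r_gt0 e_gt0 mass energy.
have h0 : 0 <= (gamma - 1)^-1 / e.
  by rewrite divr_ge0 ?invr_ge0 ?subr_ge0 ?(ltW gamma1) ?(ltW e_gt0).
(* The tangent plane at the new state, compared with the old one. *)
have gap0 := mulr_ge0 c0
  (entropy_gap_ge0 gamma1 r_gt0 e_gt0 r0_gt0 e0_gt0).
have {energy} := mulr_ge0 h0 energy.
have -> : \sum_(i in A) m i * (v i * entropy_gap gamma r e (rf i) (ef i)) =
    \sum_(i in A) m i * entropy gamma (rf i) (ef i) * v i
    - entropy_slope gamma r e * (\sum_(i in A) m i * rf i * v i)
    + (gamma - 1)^-1 / e * (\sum_(i in A) m i * rf i * v i * ef i)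
    + r * \sum_(i in A) m i * v i.
  rewrite !mulr_sumr -sumrB -!big_split /=; apply: eq_bigr => i _.
  by rewrite /entropy_gap; ring.
move: mass; set SF := \sum_(i in A) _; set SE := \sum_(i in A) _.
set SV := \sum_(i in A) _; set SH := \sum_(i in A) _ => mass.
have -> : SF = - (c * (r - r0)) by apply/eqP; rewrite -addr_eq0 addrC mass.
have diag := entropy_gap_diag r gamma1 e_gt0.
have -> : (gamma - 1)^-1 / e *
    (c * (r * e - r0 * e0) + SE + (gamma - 1) * r * e * SV) =
    (gamma - 1)^-1 / e * (c * (r * e - r0 * e0)) + (gamma - 1)^-1 / e * SE
    + r * SV.
  by field; rewrite !gt_eqF ?subr_gt0.
(* This identity eliminates the value of the tangent plane at the new state:
   what remains is linear in the products of [c] and the entropies. *)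
have : c * entropy_gap gamma r e r e = 0 by rewrite diag mulr0.
move: gap0; rewrite /entropy_gap.
move: (entropy gamma r e) (entropy gamma r0 e0) (entropy_slope _ _ _).
by move: (_ / e) => b H H0 a; lra.
Qed.

(** An internal face has two cells only, so the pair named in the upwind
    choice contains [K].  If the fluid leaves [K] the face state is the state
    of [K] and the gap is zero; otherwise the velocity is nonpositive and the
    gap nonnegative.  Both namings of the pair lead to the same conclusion,
    the velocity being antisymmetric. *)
Lemma upwind_entropy_gap_le0 (R : realType) (d : nat) (Omega : set 'rV[R]_d)
    (M : mesh Omega) (gamma : R) (u : cell M -> face M -> R)
    (rho e : cell M -> R) (rhof ef : face M -> R) (K : cell M)
    (sigma : face M) :
  1 < gamma ->
  (forall L, 0 < rho L) -> (forall L, 0 < e L) ->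
  (forall tau, internal tau -> 0 < rhof tau) ->
  (forall tau, internal tau -> 0 < ef tau) ->
  (forall tau L L', separates tau L L' -> u L tau = - u L' tau) ->
  (forall tau L, tau \in faces L -> external tau -> u L tau = 0) ->
  upwind u rho e rhof ef -> sigma \in faces K ->
  u K sigma * entropy_gap gamma (rho K) (e K) (rhof sigma) (ef sigma) <= 0.
Proof.
move=> gamma1 rho0 e0 rhof0 ef0 u_opp u_ext upw sigmaK.
have [int_sigma|ext_sigma] := face_location sigma; last first.
  by rewrite u_ext// mul0r.
have gap0 := entropy_gap_ge0 gamma1 (rho0 K) (e0 K)
  (rhof0 _ int_sigma) (ef0 _ int_sigma).
have [L [L' [sepLL' face_state]]] := upw _ int_sigma.
have uLL' := u_opp _ _ _ sepLL'.
have [_ neqLL' sigmaL sigmaL'] := sepLL'.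
have : K \in [set L; L']%SET.
  suff -> : [set L; L']%SET = [set K' | sigma \in faces K']%SET by rewrite inE.
  apply/eqP; rewrite eqEcard cards2 neqLL' cardsE (face_shared int_sigma) leqnn.
  by rewrite andbT; apply/fintype.subsetP => K'; rewrite !inE => /orP[] /eqP ->.
rewrite !inE => /orP[] /eqP KE; move: face_state; case: ifPn => uL [rfE efE].
- by rewrite rfE efE -KE entropy_gap_diag// mulr0.
- by rewrite mulr_le0_ge0// KE ltW// ltNge.
- by rewrite mulr_le0_ge0// KE -oppr_ge0 -uLL'.
- by rewrite rfE efE -KE entropy_gap_diag// mulr0.
Qed.

Theorem theorem1 (R : realType) (d : nat) (hd : (1 <= d <= 3)%N)
  (Omega : set 'rV[R]_d) (Omega_open : open Omega)
  (Omega_bounded : bounded_set Omega)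
  (Omega_connected : connected Omega)
  (M : mesh Omega)
  (gamma : R) (gamma_gt1 : 1 < gamma)
  (T dt : R) (N : nat) (t : nat -> R)
  (T_gt0 : 0 < T) (dt_gt0 : 0 < dt)
  (t0 : t 0%N = 0) (tN : t N = T)
  (t_step : forall n, (n < N)%N -> t n.+1 - t n = dt)
  (rho e p : nat -> cell M -> R)
  (u : nat -> cell M -> face M -> R)
  (rhof ef : nat -> face M -> R)
  (u_opp : forall n sigma K L, (n <= N)%N -> separates sigma K L ->
     u n K sigma = - u n L sigma)
  (u_ext : forall n K sigma, (n <= N)%N -> sigma \in faces K ->
     external sigma -> u n K sigma = 0)
  (rho_gt0 : forall n K, (n <= N)%N -> 0 < rho n K)
  (e_gt0 : forall n K, (n <= N)%N -> 0 < e n K)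
  (rhof_gt0 : forall n sigma, (n <= N)%N -> internal sigma ->
     0 < rhof n sigma)
  (ef_gt0 : forall n sigma, (n <= N)%N -> internal sigma -> 0 < ef n sigma)
  (F : nat -> cell M -> face M -> R)
  (flux : forall n K sigma, (n < N)%N -> sigma \in faces K ->
     F n.+1 K sigma = face_measure sigma * rhof n.+1 sigma * u n.+1 K sigma)
  (mass : forall n K, (n < N)%N ->
     cell_measure K / dt * (rho n.+1 K - rho n K)
     + \sum_(sigma in faces K) F n.+1 K sigma = 0)
  (energy : forall n K, (n < N)%N ->
     0 <= cell_measure K / dt * (rho n.+1 K * e n.+1 K - rho n K * e n K)
          + \sum_(sigma in faces K) F n.+1 K sigma * ef n.+1 sigma
          + p n.+1 K *
            \sum_(sigma in faces K) face_measure sigma * u n.+1 K sigma)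
  (eos : forall n K, (n < N)%N ->
     p n.+1 K = (gamma - 1) * rho n.+1 K * e n.+1 K)
  (upw : forall n, (n < N)%N ->
     upwind (u n.+1) (rho n.+1) (e n.+1) (rhof n.+1) (ef n.+1)) :
  forall n K, (n < N)%N ->
    cell_measure K / dt *
      (entropy gamma (rho n.+1 K) (e n.+1 K) - entropy gamma (rho n K) (e n K))
    + \sum_(sigma in faces K)
        face_measure sigma * entropy gamma (rhof n.+1 sigma) (ef n.+1 sigma)
        * u n.+1 K sigma
    <= 0.
Proof.
move=> n K nN; have n1N : (n.+1 <= N)%N := nN; have n0N := ltnW nN.
apply: le_trans (_ : \sum_(sigma in faces K) face_measure sigma *
    (u n.+1 K sigma * entropy_gap gamma (rho n.+1 K) (e n.+1 K)
       (rhof n.+1 sigma) (ef n.+1 sigma)) <= 0); last first.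
  apply: sumr_le0 => sigma sigmaK; apply: mulr_ge0_le0.
    exact/fine_ge0/hausdorff_measure_ge0.
  apply: upwind_entropy_gap_le0 (upw n nN) sigmaK => //.
  - by move=> L; exact: rho_gt0.
  - by move=> L; exact: e_gt0.
  - by move=> tau; exact: rhof_gt0.
  - by move=> tau; exact: ef_gt0.
  - by move=> tau L L'; exact: u_opp.
  - by move=> tau L; exact: u_ext.
apply: entropy_balance_le; rewrite ?rho_gt0 ?e_gt0//.
- by rewrite divr_ge0 ?(ltW dt_gt0)// fine_ge0// lebesgue_outer_ge0.
- apply: etrans (mass n K nN); congr (_ + _).
  by apply: eq_bigr => sigma sigmaK; rewrite flux.
- apply: le_trans (energy n K nN) _; rewrite eos//.
  rewrite lerD2r lerD2l; apply: ler_sum => sigma sigmaK.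
  by rewrite flux.
Qed.
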